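(* Fix $\alpha\ge0$. Given any sample data $\underline x_n$, let $\widehat\phi_n=\widehat\phi(\cdot;\underline x_n)$ be an approximate $R^{(\alpha)}$-Bayes estimator (or the $R^{(\alpha)}$-Bayes estimator) of $\phi_P$ with respect to a loss function $L_n$ that is bounded, with bound $\bar L$, and equivalent to a pseudo-metric $d_n$, with associated functions $h_1,h_2$. For any $\epsilon>0$, define $A_{\epsilon,n}=\{\theta:d_n(\phi_P,\phi_\theta)\le\epsilon\}$. Then $$d_n(\phi_P,\widehat\phi_n)\le\epsilon+h_2\left(\frac{\epsilon+\bar L\,\pi_n^{(\alpha)}\big(A^c_{h_1^{-1}(\epsilon),n}|\underline x_n\big)}{1-\pi_n^{(\alpha)}\big(A^c_{\epsilon,n}|\underline x_n\big)}\right).$$ Consequently, if $\lim_{n\to\infty}\pi_n^{(\alpha)}(A^c_{\epsilon,n}|\underline X_n)=0$ in probability or with probability one for all $\epsilon>0$, then $\lim_{n\to\infty}d_n(\phi_P,\widehat\phi_n)=0$ in probability or with probability one, respectively.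
   Context: General set-up. For each sample size $n\ge1$, $\underline X_n$ is a random element, defined on an underlying true probability space $(\Omega,\mathcal B_\Omega,P)$, with values in a measurable space $(\chi_n,\mathcal B_n)$, whose law has a density with respect to a $\sigma$-finite measure $\lambda^n$. The model is a family $\{F^n(\cdot|\theta):\theta\in\Theta_n\}$, $\Theta_n\subseteq\mathbb R^p$, with densities $f^n(\cdot|\theta)$ with respect to $\lambda^n$; $\Theta_n$ carries a $\sigma$-field $\mathcal B_{\Theta_n}$ and a prior measure $\pi_n$ with $\pi_n(\Theta_n)\le1$. The $\alpha$-likelihood $q_n^{(\alpha)}(\underline x_n|\theta)$, $\alpha\ge0$, is a function that is $\mathcal B_{\Theta_n}$-measurable in $\theta$ for each $\underline x_n$ and jointly $\mathcal B_n\times\mathcal B_{\Theta_n}$-measurable, with $q_n^{(0)}(\underline x_n|\theta):=\lim_{\alpha\downarrow0}q_n^{(\alpha)}(\underline x_n|\theta)=\log f^n(\underline x_n|\theta)-n$ for all $\underline x_n\in\chi_n$. The $R^{(\alpha)}$-posterior is $$\pi_n^{(\alpha)}(A|\underline x_n)=\frac{\int_A\exp(q_n^{(\alpha)}(\underline x_n|\theta))\,\pi_n(\theta)\,d\theta}{\int_{\Theta_n}\exp(q_n^{(\alpha)}(\underline x_n|\theta))\,\pi_n(\theta)\,d\theta},\qquad A\in\mathcal B_{\Theta_n},$$ whenever the denominator is finite and positive (otherwise it is defined arbitrarily, e.g. as $\pi_n(A)$). $\phi$ is a functional assigning $\phi_Q=\phi(Q)$ to probability measures $Q$; $\phi_P$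 is its value at the true probability and $\phi_\theta=\phi_{F^n(\cdot|\theta)}$. The action space is $\Phi=\{\phi_Q: Q\text{ a probability measure on }(\Omega,\mathcal B_\Omega)\}$. A loss function $L_n$ is a non-negative function on $\Phi\times\Phi$, with $L_n(\phi,\widehat\phi)$ the loss in estimating $\phi$ by $\widehat\phi$, such that $\theta\mapsto L_n(\phi_\theta,\phi)$ is $\mathcal B_{\Theta_n}$-measurable for each $\phi\in\Phi$. The $R^{(\alpha)}$-Bayes estimator is $\widehat\phi=\arg\min_{\phi\in\Phi}\int L_n(\phi_\theta,\phi)\,\pi_n^{(\alpha)}(d\theta|\underline x_n)$, provided the minimum is attained. An approximate $R^{(\alpha)}$-Bayes estimator is any $\widehat\phi$ with $$\int L_n(\phi_\theta,\widehat\phi)\,\pi_n^{(\alpha)}(d\theta|\underline x_n)\le\inf_{\phi\in\Phi}\int L_n(\phi_\theta,\phi)\,\pi_n^{(\alpha)}(d\theta|\underline x_n)+\delta_n,\qquad\lim_{n\to\infty}\delta_n=0.$$ The loss $L_n$ is bounded if there is $\bar L<\infty$ with $L_n(\phi_\theta,\phi_P)\le\bar L$ for all $n$ and all $\theta\in\Theta_n$. The loss $L_n$ is equivalent to a pseudo-metric $d_n$ on $\Phi\times\Phi$ if there exist two strictly increasing functions $h_1,h_2$ on $[0,\infty)$, continuous at $0$ with $h_1(0)=h_2(0)=0$, such that $L_n\le h_1(d_n)$ and $d_n\le h_2(L_n)$ on $\Phi\times\Phi$ for all $n$.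
   Formalization: For an approximate Bayes estimator the printed bound is false, so δ_n is added to the numerator inside h_2 (the exact Bayes bound is as printed); and where the posterior's denominator is zero or infinite, its arbitrary value must be a probability measure, since consistency fails for π_n=0. *)

(* Defs.v *)
From HB Require Import structures.
From mathcomp Require Import all_boot all_order all_algebra.
From mathcomp Require Import all_classical all_reals all_analysis.
From mathcomp Require Import measurable_realfun.

Set Implicit Arguments.
Unset Strict Implicit.
Unset Printing Implicit Defensive.

Import Order.TTheory GRing.Theory Num.Theory.
Import numFieldNormedType.Exports.

Local Open Scope classical_set_scope.
Local Open Scope ring_scope.

Definition density_of d (T : measurableType d) (R : realType)
    (mu lambda : {measure set T -> \bar R}) (g : T -> R) : Prop :=
  [/\ measurable_fun setT g,
      forall x, 0 <= g x &
      forall A, measurable A -> mu A = (\int[lambda]_(x in A) (g x)%:E)%E].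

(* [q a x t] is the a-likelihood q^(a)(x | t) at sample size [n], [f x t] the
   model density. Values lie in \bar R because log f(x | t) = -oo where the
   density vanishes ([lne] is the logarithm extended by lne 0 = -oo). *)
Record alpha_likelihood dX dT (X : measurableType dX) (T : measurableType dT)
    (R : realType) (n : nat) (f : X -> T -> R) (q : R -> X -> T -> \bar R) :
    Prop := AlphaLikelihood {
  alpha_likelihood_measurable : forall a, 0 <= a ->
    forall x, measurable_fun setT (q a x) ;
  alpha_likelihood_jointly_measurable : forall a, 0 <= a ->
    measurable_fun setT (fun z : X * T => q a z.1 z.2) ;
  alpha_likelihood_cvg0 : forall x t, q a x t @[a --> 0^'+] --> q 0 x t ;
  alpha_likelihood0 : forall x t,
    q 0 x t = (lne (f x t)%:E - n%:R%:E)%E }.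

Lemma measurable_expeR (R : realType) : measurable_fun setT (@expeR R).
Proof.
apply: (measurability _ (ErealGenOInfty.measurableE R)) => //.
move=> _ [_ [r ->] <-]; rewrite setTI.
have [r0|r0] := ltP r%:E 0%E.
  rewrite (_ : _ @^-1` _ = setT)//; apply/seteqP; split => // x _ /=.
  by rewrite in_itv/= andbT (lt_le_trans r0)// expeR_ge0.
have [y yr] := expeR_total r0.
rewrite (_ : _ @^-1` _ = [set` `]y, +oo[]); first exact: emeasurable_itv.
by apply/seteqP; split => x /=; rewrite !in_itv/= !andbT -yr lte_expeR.
Qed.

Section posterior.
Context d (T : measurableType d) (R : realType).
Variable pi : {measure set T -> \bar R}.

Definition exp_weight (q : T -> \bar R) of measurable_fun setT q :=
  fun A : set T => (\int[pi]_(t in A) expeR (q t))%E.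

Variables (q : T -> \bar R) (mq : measurable_fun setT q).

Let exp_weight0 : exp_weight mq set0 = 0%E.
Proof. exact: integral_set0. Qed.

Let exp_weight_ge0 A : (0 <= exp_weight mq A)%E.
Proof. by apply: integral_ge0 => t _; exact: expeR_ge0. Qed.

Let exp_weight_sigma_additive : semi_sigma_additive (exp_weight mq).
Proof.
apply: semi_sigma_additive_nng_induced => [|t]; last exact: expeR_ge0.
exact: measurableT_comp (@measurable_expeR R) mq.
Qed.

HB.instance Definition _ := isMeasure.Build _ _ _ (exp_weight mq)
  exp_weight0 exp_weight_ge0 exp_weight_sigma_additive.

(* [mnormalize mu nu] is mu(.) / mu(T) when 0 < mu(T) < +oo and nu otherwise:
   [nu] is the arbitrary value of the posterior in the degenerate case. *)
Definition Rposterior (nu : probability T R) : probability T R :=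
  mnormalize (exp_weight mq) nu.

End posterior.

Record loss_function d (T : measurableType d) (R : realType) (V : Type)
    (Phi : set V) (phiT : T -> V) (L : V -> V -> R) : Prop := LossFunction {
  loss_ge0 : forall u v, Phi u -> Phi v -> 0 <= L u v ;
  loss_measurable : forall v, Phi v ->
    measurable_fun setT (fun t => L (phiT t) v) }.

Record pseudo_metric (R : realType) (V : Type) (Phi : set V)
    (dist : V -> V -> R) : Prop := PseudoMetric {
  pseudo_metric_ge0 : forall u v, Phi u -> Phi v -> 0 <= dist u v ;
  pseudo_metric_refl : forall u, Phi u -> dist u u = 0 ;
  pseudo_metric_sym : forall u v, Phi u -> Phi v -> dist u v = dist v u ;
  pseudo_metric_triangle : forall u v w, Phi u -> Phi v -> Phi w ->
    dist u w <= dist u v + dist v w }.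

(* Only the restriction of [h] to [0, +oo[ matters. *)
Record increasing_at_origin (R : realType) (h : R -> R) : Prop :=
  IncreasingAtOrigin {
  increasing_on_nonneg : forall x y, 0 <= x -> x < y -> h x < h y ;
  continuous_at_origin : h x @[x --> 0^'+] --> h 0 ;
  value_at_origin : h 0 = 0 }.

Record loss_equivalent (R : realType) (V : Type) (Phi : set V)
    (L dist : nat -> V -> V -> R) (h1 h2 : R -> R) : Prop := LossEquivalent {
  loss_equivalent_h1 : increasing_at_origin h1 ;
  loss_equivalent_h2 : increasing_at_origin h2 ;
  loss_le_dist : forall n u v, Phi u -> Phi v -> L n u v <= h1 (dist n u v) ;
  dist_le_loss : forall n u v, Phi u -> Phi v -> dist n u v <= h2 (L n u v) }.

Section bayes.
Context d (T : measurableType d) (R : realType) (V : Type).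
Variables (Phi : set V) (phiT : T -> V) (L : V -> V -> R).
Variable Q : probability T R.

Definition posterior_risk (v : V) : \bar R :=
  (\int[Q]_t (L (phiT t) v)%:E)%E.

Definition is_bayes (v : V) : Prop :=
  Phi v /\ forall u, Phi u -> (posterior_risk v <= posterior_risk u)%E.

Definition is_approx_bayes (delta : R) (v : V) : Prop :=
  Phi v /\ (posterior_risk v <=
            ereal_inf [set posterior_risk u | u in Phi] + delta%:E)%E.

End bayes.

(* [P^*] is the outer measure induced by P. It coincides with P on measurable
   sets, so that this is the usual convergence in probability when the Y n are
   measurable, and no measurability of the Y n is needed for it to make sense. *)
Definition cvg_in_probability d (T : measurableType d) (R : realType)
    (P : probability T R) (Y : nat -> T -> R) (l : R) : Prop :=
  forall e : R, 0 < e ->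
    (fun n => (P^*)%mu [set w | e < `|Y n w - l|]) @ \oo --> 0%E.

Definition cvg_almost_surely d (T : measurableType d) (R : realType)
    (P : probability T R) (Y : nat -> T -> R) (l : R) : Prop :=
  {ae P, forall w, (fun n => Y n w) @ \oo --> l}.

(* Main.v *)
(* Let A_r be the d_n-ball of radius r around phi_P and D := d_n(phi_P, phihat).
   Splitting the risk of phi_P along A_eta gives at most
   eps + Lbar * post(A_eta^c), hence the risk of phihat is at most
   num := eps + Lbar * post(A_eta^c) + s. On A_eps, the triangle inequality
   gives D - eps <= h2(L_n(phi_theta, phihat)). If D - eps exceeded h2(K) with
   K := num / post(A_eps), the loss would exceed K on all of A_eps and the risk
   of phihat would exceed num. Both limits follow by choosing eps, then eta, so
   small that the bound is below a given e as soon as the posterior masses of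
   A_eps^c and A_eta^c and the slack s are small. *)
Require Import Defs.
From HB Require Import structures.
From mathcomp Require Import all_boot all_order all_algebra.
From mathcomp Require Import all_classical all_reals all_analysis.
From mathcomp Require Import measurable_realfun.
From mathcomp Require Import lra.

Set Implicit Arguments.
Unset Strict Implicit.
Unset Printing Implicit Defensive.

Import Order.TTheory GRing.Theory Num.Theory.
Import numFieldNormedType.Exports.

Local Open Scope classical_set_scope.
Local Open Scope ring_scope.

(** * Strict integral bounds and risk comparison for the estimators *)

Lemma integral_gt_cst d (T : measurableType d) (R : realType)
    (mu : {measure set T -> \bar R}) (A : set T) (g : T -> R) (K m : R) :
  measurable A -> measurable_fun A g -> 0 <= K ->
  (forall t, A t -> K < g t) -> mu A = m%:E -> 0 < m ->
  ((K * m)%:E < \int[mu]_(t in A) (g t)%:E)%E.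
Proof.
move=> mA mg K0 Kg Am m0.
have mgK : measurable_fun A (fun t => (g t - K)%:E).
  by apply/measurable_EFinP; apply: measurable_funB.
have gK0 t : A t -> (0 <= (g t - K)%:E)%E.
  by move=> /Kg Kgt; rewrite lee_fin subr_ge0 ltW.
(* Both summands are nonnegative on [A], so the integral splits without integrability of [g]. *)
rewrite (eq_integral (fun t => cst K%:E t + (g t - K)%:E)%E); last first.
  by move=> t _; rewrite /= -EFinD addrC subrK.
rewrite ge0_integralD// integral_cst// Am -EFinM lteDl//.
(* A zero integral would make [g - K] vanish almost everywhere on [A]; it is positive there, so [A]
   would be null, against [0 < m]. *)
rewrite lt0e integral_ge0// andbT; apply/eqP => I0.
suff : mu A = 0%E by rewrite Am => -[m0']; rewrite m0' ltxx in m0.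
have [+ _] := ae_eq_integral_abs mu mA mgK.
move=> /(_ _)[|N [mN N0 AN]].
  rewrite -[RHS]I0; apply: eq_integral => t; rewrite inE => At.
  by rewrite gee0_abs// gK0.
apply/eqP; rewrite -measure_le0 -N0 le_measure ?inE// => t At; apply: AN => /=.
move=> /(_ At)/eqP; rewrite eqe subr_eq0 => /eqP gtK.
by have := Kg _ At; rewrite gtK ltxx.
Qed.

(** The term [0%:E] makes the exact estimator a case of a risk inequality with slack. *)
Lemma is_bayes_le d (T : measurableType d) (R : realType) (V : Type)
    (Phi : set V) (phiT : T -> V) (L : V -> V -> R) (Q : probability T R)
    (v u : V) : is_bayes Phi phiT L Q v -> Phi u ->
  (posterior_risk phiT L Q v <= posterior_risk phiT L Q u + 0%:E)%E.
Proof. by move=> [_ +] Pu => /(_ _ Pu); rewrite adde0. Qed.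

Lemma is_approx_bayes_le d (T : measurableType d) (R : realType) (V : Type)
    (Phi : set V) (phiT : T -> V) (L : V -> V -> R) (Q : probability T R)
    (delta : R) (v u : V) : is_approx_bayes Phi phiT L Q delta v -> Phi u ->
  (posterior_risk phiT L Q v <= posterior_risk phiT L Q u + delta%:E)%E.
Proof.
move=> [_ +] Pu => /le_trans; apply; rewrite leeD2r//.
by apply: ereal_inf_lbound; exists u.
Qed.

(** * Finite-sample bound for a single posterior [Q] *)

Section risk_bounds.
Context d (T : measurableType d) (R : realType) (V : Type).
Variables (Phi : set V) (phiT : T -> V) (L dist : V -> V -> R) (h1 h2 : R -> R).
Variables (Q : probability T R) (v0 : V) (Lbar : R).
Hypotheses (phiT_Phi : forall t, Phi (phiT t)) (v0_Phi : Phi v0).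
Hypotheses (lossL : loss_function Phi phiT L)
  (L_le : forall t, L (phiT t) v0 <= Lbar).
Hypothesis dist_pm : pseudo_metric Phi dist.
Hypotheses (h1_incr : increasing_at_origin h1)
  (h2_incr : increasing_at_origin h2).
Hypotheses (L_le_dist : forall u v, Phi u -> Phi v -> L u v <= h1 (dist u v))
  (dist_le_L : forall u v, Phi u -> Phi v -> dist u v <= h2 (L u v)).

Let A eps := [set t | dist v0 (phiT t) <= eps].
Hypothesis measurable_A : forall eps, 0 < eps -> measurable (A eps).

Let nondecreasing_nonneg (h : R -> R) x y :
  increasing_at_origin h -> 0 <= x -> x <= y -> h x <= h y.
Proof.
move=> hi x0; rewrite le_eqVlt => /predU1P[->//|xy].
by rewrite ltW// (increasing_on_nonneg hi).
Qed.

Lemma posterior_risk_target_le eps eta : 0 < eps -> 0 < eta -> h1 eta <= eps ->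
  (posterior_risk phiT L Q v0 <= (eps + Lbar * fine (Q (~` A eta)))%:E)%E.
Proof.
move=> eps0 eta0 h1eta.
have mA := measurable_A eta0.
have mAc : measurable (~` A eta) by exact: measurableC.
have mL : measurable_fun setT (fun t => (L (phiT t) v0)%:E).
  by apply/measurable_EFinP; exact: (loss_measurable lossL).
have L0 t : (0 <= (L (phiT t) v0)%:E)%E.
  by rewrite lee_fin (loss_ge0 lossL).
rewrite /posterior_risk -(setUv (A eta)) ge0_integral_setU ?setUv//; last first.
  by apply/disj_setPS => t [].
rewrite EFinD EFinM fineK ?fin_num_measure// leeD//.
- apply: (@le_trans _ _ (eps%:E * Q (A eta))%E).
    rewrite -integral_cst//; apply: ge0_le_integral => //.
    + exact: measurable_funTS.
    + move=> t At; rewrite lee_fin (le_trans _ h1eta)//.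
      rewrite (le_trans (L_le_dist _ _))// nondecreasing_nonneg//.
        exact: (pseudo_metric_ge0 dist_pm).
      by rewrite (pseudo_metric_sym dist_pm).
  rewrite -[leRHS]mule1 lee_pmul2l// ?probability_le1//.
- rewrite -integral_cst//; apply: ge0_le_integral => //.
  + exact: measurable_funTS.
  + by move=> t _; rewrite lee_fin.
Qed.

Lemma dist_estimator_le (v : V) (s eps eta : R) : Phi v ->
  (posterior_risk phiT L Q v <= posterior_risk phiT L Q v0 + s%:E)%E ->
  0 < eps -> 0 < eta -> h1 eta <= eps -> (Q (~` A eps) < 1)%E ->
  dist v0 v <= eps + h2 ((eps + Lbar * fine (Q (~` A eta)) + s) /
                         (1 - fine (Q (~` A eps)))).
Proof.
move=> Pv vs eps0 eta0 h1eta Q1.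
have mA := measurable_A eps0.
set num := (X in X / _); set den := 1 - _; set K := num / den.
have den_gt0 : 0 < den.
  by rewrite subr_gt0 -lte_fin fineK// fin_num_measure//; exact: measurableC.
have denE : den%:E = Q (A eps).
  rewrite -[A eps in RHS]setCK probability_setC; last exact: measurableC.
  by rewrite EFinB fineK// fin_num_measure//; exact: measurableC.
have L0 t : (0 <= (L (phiT t) v)%:E)%E by rewrite lee_fin (loss_ge0 lossL).
have riskv : (posterior_risk phiT L Q v <= num%:E)%E.
  by rewrite (le_trans vs)// EFinD leeD2r// posterior_risk_target_le.
(* The signs of [Lbar] and [s] are unknown; [num] is nonnegative because it bounds a nonnegative
   risk. *)
have num_ge0 : 0 <= num.
  by rewrite -lee_fin (le_trans _ riskv)//; exact: integral_ge0.
have K_ge0 : 0 <= K by rewrite divr_ge0// ltW.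
rewrite leNgt; apply/negP => far.
(* The loss exceeds K on A eps, hence the risk exceeds K * Q (A eps) = num. *)
have K_lt t : A eps t -> K < L (phiT t) v.
  move=> At; rewrite ltNge; apply/negP => LK; move: far; rewrite ltNge.
  rewrite (le_trans (pseudo_metric_triangle dist_pm v0_Phi (phiT_Phi t) Pv))//.
  rewrite lerD// (le_trans (dist_le_L _ _))// nondecreasing_nonneg//.
  exact: (loss_ge0 lossL).
have mL : measurable_fun setT (fun t => L (phiT t) v).
  exact: (loss_measurable lossL).
have := integral_gt_cst mA (measurable_funTS mL) K_ge0 K_lt (esym denE) den_gt0.
rewrite divfK ?gt_eqF// ltNge => /negP; apply.
(* The loss is nonnegative, so its integral over [A eps] is at most the whole risk. *)
apply: le_trans riskv; apply: ge0_subset_integral => //.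
exact/measurable_EFinP.
Qed.

End risk_bounds.

(** * Choice of the radii and of the tolerance *)

Lemma increasing_at_origin_small (R : realType) (h : R -> R) (c : R) :
  increasing_at_origin h -> 0 < c -> exists2 r, 0 < r & h r < c.
Proof.
move=> hi c0; have := continuous_at_origin hi; rewrite (value_at_origin hi).
move=> /cvgr_lt/(_ _ c0) hc.
have /filter_ex[r [r0 hr]] : \forall r \near (0 : R)^'+, 0 < r /\ h r < c.
  by near=> r; split; near: r => //; exact: nbhs_right_gt.
by exists r.
Unshelve. all: end_near. Qed.

(** The real arithmetic shared by both limits: [D] is the distance, [a] and [b] are the posterior
    masses outside the balls of radii [eta] and [eps], and [s] is the slack. *)
Lemma bound_small (R : realType) (h1 h2 : R -> R) (Lbar e : R) :
  increasing_at_origin h1 -> increasing_at_origin h2 -> 0 < e ->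
  exists eps eta tau, [/\ 0 < eps, 0 < eta, h1 eta <= eps, 0 < tau &
    forall D a b s, `|a| <= tau -> `|b| <= tau -> `|s| <= tau ->
    (b < 1 -> D <= eps + h2 ((eps + Lbar * a + s) / (1 - b))) -> D <= e].
Proof.
move=> h1i h2i e0.
have e20 : 0 < e / 2 by rewrite divr_gt0.
have [r r0 h2r] := increasing_at_origin_small h2i e20.
(* One half of [e] pays for [eps], the other for [h2 r]. The numerator will be at most
   [3 / 2 * eps], hence below [r / 2]. *)
pose eps := Num.min (e / 2) (r / 4).
have eps0 : 0 < eps by rewrite lt_min e20 divr_gt0.
have epse : eps <= e / 2 by rewrite ge_min lexx.
have epsr : eps <= r / 4 by rewrite ge_min lexx orbT.
have [eta eta0 h1eta] := increasing_at_origin_small h1i eps0.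
have Lp : 0 < `|Lbar| + 1 by rewrite ltr_wpDl.
(* The first term keeps [1 - b] at least [1 / 2]; the second keeps [Lbar * a + s] within [eps / 2]
   of zero, the [+ 1] accounting for [s]. *)
pose tau := Num.min (1 / 2) (eps / 2 / (`|Lbar| + 1)).
have tau0 : 0 < tau by rewrite lt_min !divr_gt0.
have tau2 : tau <= 1 / 2 by rewrite ge_min lexx.
have tauL : `|Lbar| * tau + tau <= eps / 2.
  rewrite -[X in _ + X]mul1r -mulrDl mulrC -ler_pdivlMr//.
  by rewrite ge_min lexx orbT.
exists eps, eta, tau; split => //; first exact: ltW.
move=> D a b s a_tau b_tau s_tau.
have La : `|Lbar * a| <= `|Lbar| * tau by rewrite normrM ler_wpM2l.
have L0 : 0 <= `|Lbar| * tau by rewrite mulr_ge0// ltW.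
move: La s_tau b_tau; rewrite !ler_norml.
move=> /andP[La1 La2] /andP[s1 s2] /andP[b1 b2].
have b0 : 0 < 1 - b by lra.
move=> /(_ _)/le_trans; apply; first by lra.
have x0 : 0 <= (eps + Lbar * a + s) / (1 - b).
  by rewrite divr_ge0//; [lra|exact: ltW].
suff : (eps + Lbar * a + s) / (1 - b) <= r.
  rewrite le_eqVlt => /predU1P[->|/(increasing_on_nonneg h2i x0)]; lra.
rewrite ler_pdivrMr//.
have : r * (1 / 2) <= r * (1 - b) by rewrite ler_pM2l//; lra.
lra.
Qed.

(** * Transfer of convergence from [Z] to [Y] *)

Section domination.
Context d (T : measurableType d) (R : realType) (P : probability T R).
Variables (Y : nat -> T -> R) (Z : R -> nat -> T -> R).
Hypothesis YZ : forall e : R, 0 < e -> exists eps eta tau,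
  [/\ 0 < eps, 0 < eta, 0 < tau & \forall n \near \oo, forall w,
    `|Z eta n w| <= tau -> `|Z eps n w| <= tau -> `|Y n w| <= e].

(** For large [n], uniformly in [w], [Y] can exceed [e] only where [Z eta] or [Z eps] exceeds [tau];
    monotonicity and subadditivity of the outer measure conclude. *)
Lemma dominated_cvg_in_probability :
  (forall eps, 0 < eps -> cvg_in_probability P (Z eps) 0) ->
  cvg_in_probability P Y 0.
Proof.
move=> Zcvg e e0.
have [eps [eta [tau [eps0 eta0 tau0 near_le]]]] := YZ e0.
pose B c n := [set w | tau < `|Z c n w - 0|].
apply: (@squeeze_cvge _ _ _ _ (cst 0%E) _
  (fun n => (P^*)%mu (B eta n) + (P^*)%mu (B eps n))%E).
- near=> n; rewrite mu_ext_ge0//=.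
  apply: le_trans (outer_measureU2 _ _ _); apply: le_mu_ext => w /= eY.
  apply: contrapT => /not_orP[/negP + /negP]; rewrite -!leNgt !subr0 => Z1 Z2.
  move: eY; rewrite subr0 ltNge => /negP; apply.
  by move: w Z1 Z2; near: n.
- exact: cvg_cst.
- by rewrite -[0%E in X in _ --> X]adde0; apply: cvgeD => //; exact: Zcvg.
Unshelve. all: end_near. Qed.

Lemma dominated_cvg_almost_surely :
  (forall eps, 0 < eps -> cvg_almost_surely P (Z eps) 0) ->
  cvg_almost_surely P Y 0.
Proof.
move=> Zcvg.
(* Restricting to the countably many tolerances [k.+1%:R^-1] lets the exceptional null sets be
   merged into one. *)
have small k : {ae P, forall w, \forall n \near \oo, `|Y n w| <= k.+1%:R^-1}.
  have [|eps [eta [tau [eps0 eta0 tau0 near_le]]]] := YZ (e := k.+1%:R^-1).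
    by rewrite invr_gt0.
  have := Zcvg _ eps0; have := Zcvg _ eta0; apply: filterS2 => w.
  move=> /cvgrPdist_le/(_ _ tau0) Zeta /cvgrPdist_le/(_ _ tau0) Zeps.
  apply: filterS3 near_le Zeta Zeps => n + Zeta Zeps; apply.
    by rewrite -normrN -sub0r.
  by rewrite -normrN -sub0r.
have := ae_foralln small; apply: filterS => w Yw.
apply/cvgrPdist_le => e e0.
have [k ke] : exists k, k.+1%:R^-1 < e.
  near \oo => k; exists k; near: k; exact: near_infty_natSinv_lt (PosNum e0).
apply: filterS (Yw k) => n; rewrite sub0r normrN => /le_trans; apply.
exact: ltW.
Unshelve. all: end_near. Qed.

End domination.

(* The index n : nat stands for the sample size n.+1. *)
Theorem theorem3p4 (R : realType) (p : nat) (dO dX dT : measure_display)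
  (* true probability space and data *)
  (Omega : measurableType dO) (P : probability Omega R)
  (chi : nat -> measurableType dX) (X : forall n, {mfun Omega >-> chi n})
  (lambda : forall n, {sigma_finite_measure set (chi n) -> \bar R})
  (X_density : forall n,
    exists g, density_of (distribution P (X n)) (lambda n) g)
  (* parameter spaces, embedded in R^p; model and prior *)
  (Theta : nat -> measurableType dT) (iota : forall n, Theta n -> 'rV[R]_p)
  (iota_inj : forall n, injective (iota n))
  (F : forall n, Theta n -> probability (chi n) R)
  (f : forall n, chi n -> Theta n -> R)
  (F_density : forall n t, density_of (F n t) (lambda n) (fun x => f n x t))
  (pi : forall n, subprobability (Theta n) R)
  (* alpha-likelihood and posterior *)
  (q : forall n, R -> chi n -> Theta n -> \bar R)
  (qP : forall n, alpha_likelihood n.+1 (f n) (q n))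
  (nu : forall n, chi n -> probability (Theta n) R)
  (alpha : R) (alpha_ge0 : 0 <= alpha)
  (* functional, loss and pseudo-metric *)
  (V : Type)
  (phi : forall (d : measure_display) (T : measurableType d),
    probability T R -> V)
  (L dist : nat -> V -> V -> R) (Lbar : R) (h1 h2 : R -> R) :
  let Phi : set V := [set phi dO Omega Q | Q in [set: probability Omega R]] in
  let phiP : V := phi dO Omega P in
  let phiT n (t : Theta n) : V := phi dX (chi n) (F n t) in
  let post n (x : chi n) : probability (Theta n) R :=
    Rposterior (pi n)
      (alpha_likelihood_measurable (qP n) alpha_ge0 x) (nu n x) in
  let A n (eps : R) : set (Theta n) :=
    [set t | dist n phiP (phiT n t) <= eps] in
  (forall n (t : Theta n), Phi (phiT n t)) ->
  (forall n, loss_function Phi (phiT n) (L n)) ->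
  (forall n (t : Theta n), L n (phiT n t) phiP <= Lbar) ->
  (forall n, pseudo_metric Phi (dist n)) ->
  loss_equivalent Phi L dist h1 h2 ->
  (forall n (eps : R), 0 < eps -> measurable (A n eps)) ->
  forall phihat : forall n, chi n -> V,
  let bayes := forall n x,
    is_bayes Phi (phiT n) (L n) (post n x) (phihat n x) in
  let approx_bayes (delta : nat -> R) :=
    delta @ \oo --> (0 : R) /\
    forall n x,
      is_approx_bayes Phi (phiT n) (L n) (post n x) (delta n) (phihat n x) in
  (* eta is h1^-1(eps) whenever h1^-1(eps) exists (h1 need not be onto); s is
     the slack in the risk of the estimator *)
  let bound n (x : chi n) (s : R) := forall eps eta : R,
    0 < eps -> 0 < eta -> h1 eta <= eps ->
    (post n x (~` A n eps) < 1)%E ->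
    dist n phiP (phihat n x) <=
      eps + h2 ((eps + Lbar * fine (post n x (~` A n eta)) + s) /
                (1 - fine (post n x (~` A n eps)))) in
  [/\ bayes -> forall n x, bound n x 0,
      forall delta, approx_bayes delta -> forall n x, bound n x (delta n),
      bayes \/ (exists delta, approx_bayes delta) ->
      (forall eps : R, 0 < eps -> cvg_in_probability P
        (fun n w => fine (post n (X n w) (~` A n eps))) 0) ->
      cvg_in_probability P (fun n w => dist n phiP (phihat n (X n w))) 0 &
      bayes \/ (exists delta, approx_bayes delta) ->
      (forall eps : R, 0 < eps -> cvg_almost_surely P
        (fun n w => fine (post n (X n w) (~` A n eps))) 0) ->
      cvg_almost_surely P (fun n w => dist n phiP (phihat n (X n w))) 0].
Proof.
move=> Phi phiP phiT post A phiT_Phi lossL L_le dist_pm [h1i h2i Lh1 Lh2] mA.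
move=> phihat bayes approx_bayes bound.
have phiP_Phi : Phi phiP by exists P.
have bound_slack n x s : Phi (phihat n x) ->
    (forall u, Phi u -> (posterior_risk (phiT n) (L n) (post n x) (phihat n x) <=
      posterior_risk (phiT n) (L n) (post n x) u + s%:E)%E) -> bound n x s.
  move=> Pv le_risk eps eta eps0 eta0 h1eta Q1.
  apply: (dist_estimator_le (phiT_Phi n) phiP_Phi (lossL n) (L_le n) (dist_pm n)
    h1i h2i (Lh1 n) (Lh2 n) (mA n)) => //.
  exact: le_risk.
have bayes_bound : bayes -> forall n x, bound n x 0.
  move=> bv n x; apply: bound_slack => [|u]; first exact: (bv n x).1.
  exact: is_bayes_le.
have approx_bound delta : approx_bayes delta -> forall n x, bound n x (delta n).
  move=> [_ bv] n x; apply: bound_slack => [|u]; first exact: (bv n x).1.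
  exact: is_approx_bayes_le.
have phihat_Phi : bayes \/ (exists delta, approx_bayes delta) ->
    forall n x, Phi (phihat n x).
  by case=> [bv n x|[delta [_ bv]] n x]; exact: (bv n x).1.
(* From here on both kinds of estimator are handled together, through a vanishing slack. *)
have slack : bayes \/ (exists delta, approx_bayes delta) ->
    exists2 s : nat -> R, s @ \oo --> (0 : R) & forall n x, bound n x (s n).
  case=> [bv|[delta bv]].
    by exists (fun=> 0); [exact: cvg_cst|exact: bayes_bound].
  by exists delta; [exact: bv.1|exact: approx_bound].
have domin : bayes \/ (exists delta, approx_bayes delta) -> forall e : R, 0 < e ->
    exists eps eta tau, [/\ 0 < eps, 0 < eta, 0 < tau &
      \forall n \near \oo, forall w,
        `|fine (post n (X n w) (~` A n eta))| <= tau ->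
        `|fine (post n (X n w) (~` A n eps))| <= tau ->
        `|dist n phiP (phihat n (X n w))| <= e].
  move=> bv e e0; have [s s0 sbound] := slack bv.
  have [eps [eta [tau [eps0 eta0 h1eta tau0 small]]]] :=
    bound_small Lbar h1i h2i e0.
  exists eps, eta, tau; split=> //.
  (* The slack does not depend on the data, so the rank beyond which it is small is uniform in
     [w]. *)
  move/cvgrPdist_le: s0 => /(_ _ tau0); apply: filterS => n s_tau w Z1 Z2.
  rewrite ger0_norm; last first.
    by apply: (pseudo_metric_ge0 (dist_pm n)) => //; exact: phihat_Phi.
  apply: small Z1 Z2 _ _; first by rewrite -normrN -sub0r; exact: s_tau.
  move=> b1; apply: sbound => //.
  rewrite -lte_fin fineK ?fin_num_measure// in b1.
  by apply: measurableC; exact: mA.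
split=> // bv.
- by apply: dominated_cvg_in_probability; exact: domin.
- by apply: dominated_cvg_almost_surely; exact: domin.
Qed.
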